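(* Let $V$ be a finite-dimensional vector space equipped with an inner product $(\cdot,\cdot)$, let $A\colon V\to V$ be symmetric positive semidefinite, and let $B\colon V\to V$ be SPD. Then $$\lambda_{\min}(BA)=\left(\sup_{v\in\mathcal R(A),\ |v|_A=1}\ \inf_{\phi\in\mathcal N(A)}(B^{-1}(v+\phi),v+\phi)\right)^{-1},$$ $$\lambda_{\max}(BA)=\left(\inf_{v\in\mathcal R(A),\ |v|_A=1}\ \inf_{\phi\in\mathcal N(A)}(B^{-1}(v+\phi),v+\phi)\right)^{-1}.$$
   Context: $\mathcal N(T)$ and $\mathcal R(T)$ are the null space and range of a linear operator $T$. A symmetric operator $T$ is SPD if $(Tv,v)>0$ for all $v\ne0$, and symmetric positive semidefinite if $(Tv,v)\ge 0$ for all $v$; then $|v|_T=(Tv,v)^{1/2}$. $\lambda_{\min}(BA)$ denotes the smallest nonzero eigenvalue and $\lambda_{\max}(BA)$ the largest eigenvalue of $BA$. *)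

(* Defs.v *)
From mathcomp Require Import all_boot all_order all_algebra.
From mathcomp Require Import boolp classical_sets reals ereal.

Set Implicit Arguments.
Unset Strict Implicit.
Unset Printing Implicit Defensive.

Import Order.TTheory GRing.Theory Num.Theory.
Local Open Scope ring_scope.
Local Open Scope classical_set_scope.

(* A real inner product is a positive definite form that is hermitian for the
   identity "conjugation", i.e. an element of {dot V for idfun}. *)
Section Operators.
Variables (R : realType) (V : vectType R) (dot : {dot V for idfun}).
Implicit Type T : 'End(V).

Definition symmetric_op T := forall u v : V, dot (T u) v = dot u (T v).

Definition SPSD T := symmetric_op T /\ forall v : V, 0 <= dot (T v) v.

Definition SPD T := symmetric_op T /\ forall v : V, v != 0 -> 0 < dot (T v) v.

Definition seminorm T (v : V) : R := Num.sqrt (dot (T v) v).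

Definition A_sphere T : set V :=
  [set v | v \in limg T /\ seminorm T v = 1].

(* The infimum over phi in N(A) of (B^-1 (v + phi), v + phi). Infima and suprema
   are taken in the extended reals, so that no boundedness is presupposed. *)
Definition inf_kernel_shift (A B : 'End(V)) (v : V) : \bar R :=
  ereal_inf [set (dot ((B^-1)%VF (v + phi)) (v + phi))%:E
            | phi in [set phi : V | phi \in lker A]].

End Operators.

Section Eigenvalues.
Variables (R : realType) (V : vectType R).
Implicit Type T : 'End(V).

Definition is_lambda_min T (l : R) :=
  [/\ passmx.leigenvalue T l, l != 0
    & forall m : R, passmx.leigenvalue T m -> m != 0 -> l <= m].

Definition is_lambda_max T (l : R) :=
  passmx.leigenvalue T l /\ forall m : R, passmx.leigenvalue T m -> m <= l.

End Eigenvalues.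

(* Main.v *)
(** Since [V] is the direct sum of [W := R(BA)] and [N(A)], which are orthogonal
    for [(B^-1 u, v)], the infimum over [phi] at [v] is [(B^-1 w, w)] with [w] the
    [W]-component of [v], and [v |-> w] maps the [A]-sphere of [R(A)] onto that of
    [W].  On [W] the nonzero eigenvalues of [BA] are the critical values of the
    quotient [(A w, w) / (B^-1 w, w)], whose extrema are attained by finite
    dimensionality. *)
Require Import Defs.
From mathcomp Require Import all_boot all_order all_algebra.
From mathcomp Require Import boolp classical_sets reals ereal.
From mathcomp Require Import ring lra.

Import Order.TTheory GRing.Theory Num.Theory.
Local Open Scope ring_scope.
Local Open Scope classical_set_scope.

(** * Forms of symmetric operators and their Rayleigh quotients *)

Section QuadraticForms.
Set Implicit Arguments.
Unset Strict Implicit.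
Context (R : realType) (V : vectType R) (dot : {dot V for idfun}).
Implicit Types (T P Q : 'End(V)) (U : {vspace V}) (u v w x y z : V) (X : seq V).

Lemma dotC u v : dot u v = dot v u.
Proof. by rewrite (hermC dot) expr0 mul1r. Qed.

Lemma dotDl u v w : dot (u + v) w = dot u w + dot v w.
Proof. exact: linearDl. Qed.

Lemma dotDr u v w : dot w (u + v) = dot w u + dot w v.
Proof. exact: linearDr. Qed.

Lemma dotNl u w : dot (- u) w = - dot u w.
Proof. exact: linearNl. Qed.

Lemma dotNr u w : dot w (- u) = - dot w u.
Proof. exact: linearNr. Qed.

Lemma dotZl c u w : dot (c *: u) w = c * dot u w.
Proof. exact: linearZl_LR. Qed.

Lemma dotZr c u w : dot w (c *: u) = c * dot w u.
Proof. exact: linearZr_LR. Qed.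

Lemma dot_gt0 u : u != 0 -> 0 < dot u u.
Proof. exact: neq0_dnorm_gt0. Qed.

Definition dotE := (dotDl, dotDr, dotNl, dotNr, dotZl, dotZr).

Definition posdef_on U T := {in U, forall u, u != 0 -> 0 < dot (T u) u}.

Lemma symmetric_opC T : symmetric_op dot T ->
  forall u v, dot (T u) v = dot (T v) u.
Proof. by move=> sT u v; rewrite sT dotC. Qed.

Lemma quadratic_form_comb T c x y : symmetric_op dot T ->
  dot (T (c *: x + y)) (c *: x + y) =
  c * c * dot (T x) x + 2 * c * dot (T x) y + dot (T y) y.
Proof.
move=> sT; rewrite (linearD T) (linearZ_LR T) /= !dotDl !dotDr !dotZl !dotZr (symmetric_opC sT y x).
by ring.
Qed.

(** Replacing the generator [e] by [e - p] does not change the span; with [p] the projection of [e]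
    this is one Gram-Schmidt step. *)
Lemma span_cons_shift e p u X : p \in <<X>>%VS -> u \in <<e :: X>>%VS ->
  exists c, exists2 r, r \in <<X>>%VS & u = c *: (e - p) + r.
Proof.
move=> pX; rewrite span_cons => /memv_addP[_ /vlineP[c ->]] [r rX ->].
exists c, (c *: p + r); first by rewrite memvD ?memvZ.
by rewrite scalerBr addrA subrK.
Qed.

(** Gram-Schmidt for the form of [T], by induction on the generators. They may be dependent, whence
    the case [e - p = 0]. *)
Lemma orthogonal_projection T X x : symmetric_op dot T ->
    posdef_on <<X>> T ->
  exists2 y, y \in <<X>>%VS & {in <<X>>%VS, forall u, dot (T (x - y)) u = 0}.
Proof.
move=> sT; elim: X x => [|e X IH] x pT.
  exists 0; first exact: mem0v.
  by move=> u; rewrite span_nil memv0 => /eqP ->; rewrite linear0r.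
have sXe : (<<X>> <= <<e :: X>>)%VS by rewrite span_cons addvSr.
have {}IH z : exists2 y, y \in <<X>>%VS &
    {in <<X>>%VS, forall u, dot (T (z - y)) u = 0}.
  by apply: IH => u uX; apply: pT; apply: (subvP sXe).
have [p pX pO] := IH e; have [y yX yO] := IH x.
have epX : e - p \in <<e :: X>>%VS.
  rewrite memvB ?(subvP sXe p pX) //.
  by rewrite memv_span ?mem_head.
have [ep0|ep_neq0] := eqVneq (e - p) 0.
  exists y; first exact: (subvP sXe).
  move=> u /(span_cons_shift pX)[c [r rX ->]].
  by rewrite ep0 scaler0 add0r yO.
pose d := dot (T (x - y)) (e - p) / dot (T (e - p)) (e - p).
exists (y + d *: (e - p)); first by rewrite memvD ?memvZ ?(subvP sXe y yX).
move=> u /(span_cons_shift pX)[c [r rX ->]].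
rewrite opprD addrA (linearD T (x - y)) -scaleNr (linearZ_LR T) /= dotDl dotZl !dotDr !dotZr.
rewrite (yO _ rX) (pO _ rX) !addr0 /d.
have : dot (T (e - p)) (e - p) != 0 by rewrite gt_eqF ?pT.
move: (dot (T (e - p)) (e - p)) (dot (T (x - y)) (e - p)) => g h g0.
by field.
Qed.

(** Replaces compactness of the unit sphere. In [u = c *: f + r] with [f] [T]-orthogonal to [<<X>>],
    the [T]-energies of the two pieces add up exactly, while the [P]-energies do so up to a factor
    2. *)
Lemma posdef_dominates P T X :
    symmetric_op dot P -> symmetric_op dot T ->
    (forall u, 0 <= dot (P u) u) -> posdef_on <<X>> T ->
  exists2 K : R, 0 < K &
    {in <<X>>%VS, forall u, dot (P u) u <= K * dot (T u) u}.
Proof.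
move=> sP sT pP; elim: X => [|e X IH] pT.
  exists 1; first exact: ltr01.
  move=> u; rewrite span_nil memv0 => /eqP ->.
  by rewrite !linear0r mulr0.
have sXe : (<<X>> <= <<e :: X>>)%VS by rewrite span_cons addvSr.
have pTX : posdef_on <<X>> T.
  by move=> u uX; apply: pT; apply: (subvP sXe).
have [K K0 KX] := IH pTX.
have [p pX pO] := orthogonal_projection e sT pTX.
set f := e - p in pO.
have fX : f \in <<e :: X>>%VS.
  rewrite memvB ?(subvP sXe p pX) //.
  by rewrite memv_span ?mem_head.
have Tf_ge0 : 0 <= dot (T f) f.
  have [->|/(pT _ fX)/ltW //] := eqVneq f 0; by rewrite linear0r.
have [L L0 Lf] : exists2 L, 0 <= L & dot (P f) f <= L * dot (T f) f.
  have [->|f0] := eqVneq f 0.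
    by exists 0; rewrite ?lexx // !linear0r mulr0.
  exists (dot (P f) f / dot (T f) f); first by rewrite divr_ge0.
  by rewrite divfK ?gt_eqF ?pT.
(* The sum stands in for the maximum of [2 * K] and [2 * L], and is positive even if [L = 0]. *)
exists (2 * K + 2 * L); first by nra.
move=> u /(span_cons_shift pX)[c [r rX ->]].
have Kr := KX r rX.
have Tr_ge0 : 0 <= dot (T r) r.
  have [->|/(pTX _ rX)/ltW //] := eqVneq r 0; by rewrite linear0r.
have Tfr := pO r rX.
(* Parallelogram identity: P(c f + r) <= 2 c^2 P(f) + 2 P(r), since P(r - c f) >= 0. *)
have := pP ((- c) *: f + r).
rewrite !quadratic_form_comb // Tfr mulr0 addr0 mulrNN.
have c2 : 0 <= c * c by rewrite -expr2 sqr_ge0.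
have := mulr_ge0 c2 Tf_ge0; have := ler_wpM2l c2 Lf.
move: (dot (P f) f) (dot (P f) r) (dot (P r) r) (dot (T f) f) (dot (T r) r)
  Kr Tr_ge0 => a b d tf tr Kr Tr H1 H2 H3.
have := mulr_ge0 L0 Tr; have := mulr_ge0 (ltW K0) H2.
by nra.
Qed.

(** Along the line [t *: w + u] the form is affine in [t], so nonnegativity forces its slope
    [2 * dot (T w) u] to vanish. *)
Lemma psd_isotropic T U w : symmetric_op dot T ->
    {in U, forall u, 0 <= dot (T u) u} -> w \in U -> dot (T w) w = 0 ->
  {in U, forall u, dot (T w) u = 0}.
Proof.
move=> sT pT wU Tww u uU; apply/eqP/negPn/negP => b0.
(* At this [t] the form takes the value -1. *)
pose t := - (dot (T u) u + 1) / (2 * dot (T w) u).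
have : 0 <= dot (T (t *: w + u)) (t *: w + u) by rewrite pT // memvD ?memvZ.
rewrite quadratic_form_comb // Tww mulr0 add0r /t.
move: (dot (T u) u) (dot (T w) u) b0 => a b b0.
suff -> : 2 * (- (a + 1) / (2 * b)) * b + a = - 1 by rewrite lerNr oppr0 ler10.
by field.
Qed.

(* The infimum of the Rayleigh quotient is attained: otherwise [P - mu Q] would
   be positive definite on [U], hence dominate [Q], and [mu] could be raised. *)
Lemma rayleigh_min P Q U c : symmetric_op dot P -> SPD dot Q ->
    {in U, forall u, c * dot (Q u) u <= dot (P u) u} -> U != 0%VS ->
  exists mu : R, exists w, [/\ w \in U, w != 0,
    {in U, forall u, mu * dot (Q u) u <= dot (P u) u} &
    {in U, forall u, dot (P w) u = mu * dot (Q w) u}].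
Proof.
move=> sP [sQ pQ] cP U0.
pose S : set R := [set m | {in U, forall u, m * dot (Q u) u <= dot (P u) u}].
have ubS u : u \in U -> u != 0 -> ubound S (dot (P u) u / dot (Q u) u).
  by move=> uU u0 m Sm; rewrite ler_pdivlMr ?pQ ?Sm.
have supS : has_sup S.
  split; first by exists c.
  exists (dot (P (vpick U)) (vpick U) / dot (Q (vpick U)) (vpick U)).
  by apply: ubS; rewrite ?memv_pick // vpick0.
pose mu := sup S; pose T := P - mu *: Q.
have dotT u v : dot (T u) v = dot (P u) v - mu * dot (Q u) v.
  by rewrite add_lfunE opp_lfunE scale_lfunE !dotE.
have sT : symmetric_op dot T.
  by move=> u v; rewrite dotT (dotC u) dotT (symmetric_opC sP u) (symmetric_opC sQ u).
have muP : {in U, forall u, mu * dot (Q u) u <= dot (P u) u}.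
  move=> u uU; have [->|u0] := eqVneq u 0; first by rewrite !linear0r mulr0.
  rewrite -ler_pdivlMr ?pQ //; apply: ge_sup; first by exists c.
  exact: ubS.
have T_ge0 : {in U, forall u, 0 <= dot (T u) u}.
  by move=> u /muP; rewrite dotT subr_ge0.
have [w [wU w0 Tw]] : exists w, [/\ w \in U, w != 0 & dot (T w) w = 0].
  apply: contrapT => noW.
  have pT : posdef_on <<vbasis U>> T.
    move=> u; rewrite (span_basis (vbasisP U)) => uU u0.
    rewrite lt_neqAle T_ge0 // andbT eq_sym.
    by apply/eqP => Tu; apply: noW; exists u.
  have Q_ge0 u : 0 <= dot (Q u) u.
    by have [->|/pQ/ltW //] := eqVneq u 0; rewrite linear0r.
  have [K K0 KT] := posdef_dominates sQ sT Q_ge0 pT.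
  suff /(sup_ubound supS.2) : S (mu + K^-1).
    by rewrite -/mu gerDl invr_le0 leNgt K0.
  move=> u uU; rewrite mulrDl -lerBrDl -dotT mulrC ler_pdivrMr // mulrC.
  by apply: KT; rewrite (span_basis (vbasisP U)).
(* As [w] is isotropic for [T = P - mu Q], which is nonnegative on [U], [psd_isotropic] yields the
   stationarity equation. *)
exists mu, w; split=> // u uU.
by apply/eqP; rewrite -subr_eq0 -dotT (psd_isotropic sT T_ge0 wU Tw).
Qed.

(** By [psd_isotropic] on the whole space, [T v] is orthogonal to every vector, itself included. *)
Lemma psd_kerP T v : SPSD dot T -> dot (T v) v = 0 -> T v = 0.
Proof.
move=> [sT pT] Tv; apply: contrapT => /eqP/dot_gt0.
by rewrite (psd_isotropic (U := fullv) sT _ _ Tv) ?ltxx ?memvf // => u _.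
Qed.

Lemma SPD_ge0 T v : SPD dot T -> 0 <= dot (T v) v.
Proof.
by move=> [_ pT]; have [->|/pT/ltW //] := eqVneq v 0; rewrite linear0r.
Qed.

Lemma SPD_eq0 T v : SPD dot T -> (dot (T v) v == 0) = (v == 0).
Proof.
move=> [_ pT]; have [->|/pT/gt_eqF //] := eqVneq v 0.
by rewrite linear0r eqxx.
Qed.

Lemma SPD_lker0 T : SPD dot T -> lker T == 0%VS.
Proof.
move=> hT; rewrite -subv0; apply/subvP => v; rewrite memv_ker memv0 => /eqP Tv.
by rewrite -(SPD_eq0 v hT) Tv linear0l.
Qed.

Lemma SPD_inv T : SPD dot T -> SPD dot T^-1%VF.
Proof.
move=> hT; have kT := SPD_lker0 hT; have [sT pT] := hT.
split=> [u v|v v0].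
  by rewrite -{1}(lker0_lfunVK kT v) -sT lker0_lfunVK.
rewrite -{2}(lker0_lfunVK kT v) dotC; apply: pT.
by apply: contra v0 => /eqP v0; rewrite -(lker0_lfunVK kT v) v0 linear0.
Qed.

Lemma leigenvalueP T l :
  reflect (exists2 v, v != 0 & T v = l *: v) (passmx.leigenvalue T l).
Proof.
have eigE v : (v \in passmx.leigenspace T l) = (T v == l *: v).
  by rewrite memv_ker add_lfunE opp_lfunE scale_lfunE id_lfunE subr_eq0.
apply: (iffP idP) => [l0|[v v0 /eqP Tv]].
  exists (vpick (passmx.leigenspace T l)); first by rewrite vpick0.
  by apply/eqP; rewrite -eigE memv_pick.
apply: contra v0 => /eqP l0; rewrite -memv0 -l0.
by rewrite eigE.
Qed.

End QuadraticForms.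

(** * The splitting of [V] into R(BA) and N(A) *)

Section PreconditionedOperator.
Set Implicit Arguments.
Unset Strict Implicit.
Context (R : realType) (V : vectType R) (dot : {dot V for idfun}).
Context (A B : 'End(V)) (hA : SPSD dot A) (hB : SPD dot B).

Local Notation W := (limg (B \o A)).
Local Notation energy v := (dot (A v) v).
Local Notation inv_energy v := (dot (B^-1%VF v) v).

Let BK : cancel B B^-1%VF. Proof. exact/lker0_lfunK/(SPD_lker0 hB). Qed.

(** If [w = B (A x)], then (B A x, A x) = (A w, x) = 0, and definiteness of [B] gives [A x = 0]. *)
Lemma limg_lker_eq0 w : w \in W -> A w = 0 -> w = 0.
Proof.
move=> /memv_imgP[x _ ->]; rewrite !lfunE /= => ABAx.
suff /eqP -> : A x == 0 by rewrite linear0.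
by rewrite -(SPD_eq0 _ hB) -hA.1 ABAx linear0l.
Qed.

(** [B] is injective, so N(BA) = N(A); rank-nullity and the trivial intersection then make the sum
    fill [V]. *)
Lemma limg_lker_decomp v : exists2 w, w \in W & v - w \in lker A.
Proof.
have kBA : lker (B \o A) = lker A.
  apply/vspaceP => u; rewrite !memv_ker lfunE /=.
  by rewrite -{1}(linear0 B) (can_eq BK).
have dirWA : (W :&: lker A = 0)%VS.
  apply/eqP; rewrite -subv0; apply/subvP => w; rewrite memv_cap memv_ker memv0.
  by move=> /andP[wW /eqP /(limg_lker_eq0 wW) ->].
have fullE : (W + lker A)%VS = fullv.
  apply/eqP; rewrite eqEdim subvf dimv_disjoint_sum //=.
  by rewrite -[leqLHS](limg_ker_dim (B \o A)) capfv kBA addnC.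
have /memv_addP[w wW [n nA ->]] : v \in (W + lker A)%VS by rewrite fullE memvf.
by exists w => //; rewrite addrC addKr.
Qed.

End PreconditionedOperator.

(** * Energies, kernel infima and eigenvectors on R(BA) *)

Section RangeEnergy.
Set Implicit Arguments.
Unset Strict Implicit.
Context (R : realType) (V : vectType R) (dot : {dot V for idfun}).
Context (A B : 'End(V)) (hA : SPSD dot A) (hB : SPD dot B).

Local Notation W := (limg (B \o A)).
Local Notation energy v := (dot (A v) v).
Local Notation inv_energy v := (dot (B^-1%VF v) v).

Let BK : cancel B B^-1%VF. Proof. exact/lker0_lfunK/(SPD_lker0 hB). Qed.
Let BVK : cancel B^-1%VF B. Proof. exact/lker0_lfunVK/(SPD_lker0 hB). Qed.

Lemma inv_energy_ortho w n : w \in W -> n \in lker A -> dot (B^-1%VF w) n = 0.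
Proof.
move=> /memv_imgP[x _ ->]; rewrite memv_ker !lfunE /= BK hA.1 => /eqP ->.
exact: linear0r.
Qed.

Lemma energy_shift v w : v - w \in lker A -> energy v = energy w.
Proof.
rewrite memv_ker linearB /= subr_eq0 => /eqP Avw.
by rewrite Avw hA.1 Avw -hA.1.
Qed.

(** Pythagoras for the form of [B^-1]: [v + phi] is [w] plus a kernel vector orthogonal to it, and
    [phi = w - v] removes the latter. *)
Lemma inf_kernel_shiftE v w : w \in W -> v - w \in lker A ->
  inf_kernel_shift dot A B v = (inv_energy w)%:E.
Proof.
move=> wW vwA; apply/eqP; rewrite eq_le; apply/andP; split.
  apply: ereal_inf_lbound; exists (- (v - w)); first by rewrite /= rpredN.
  by rewrite opprB addrC subrK.
apply: le_ereal_inf_tmp => _ [phi phiA <-]; rewrite lee_fin.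
have [n nA ->] : exists2 n, n \in lker A & v + phi = 1 *: w + n.
  exists (v - w + phi); first by rewrite memvD.
  by rewrite scale1r addrA [w + _]addrC subrK.
have hBV := SPD_inv hB.
rewrite (quadratic_form_comb _ _ _ hBV.1) (inv_energy_ortho wW nA) mulr0 addr0 !mul1r.
by rewrite lerDl SPD_ge0.
Qed.

(** R(A) and [W] are both complements of N(A), and passing from one to the other along N(A)
    preserves the energy. *)
Lemma inf_kernel_shift_image :
  [set inf_kernel_shift dot A B v | v in A_sphere dot A] =
  [set (inv_energy w)%:E | w in [set w | w \in W /\ energy w = 1]].
Proof.
apply/seteqP; split=> [_ [v [_ vE] <-]|_ [w [wW wE] <-]].
  have [w wW vwA] := limg_lker_decomp hA hB v.
  exists w; last by rewrite (inf_kernel_shiftE wW vwA).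
  split=> //; rewrite -(energy_shift vwA).
  by rewrite -[LHS]sqr_sqrtr ?hA.2 // -/(seminorm dot A v) vE expr1n.
(* With the identity in place of [B], the decomposition becomes R(A) + N(A). *)
have id_SPD : SPD dot \1%VF.
  by split=> [u v|v v0]; rewrite !id_lfunE // dot_gt0.
have [v vA wvA] := limg_lker_decomp hA id_SPD w.
have vwA : v - w \in lker A by rewrite -opprB rpredN.
exists v; last by rewrite (inf_kernel_shiftE wW vwA).
split; first by rewrite comp_lfun1l in vA.
by rewrite /seminorm (energy_shift vwA) wE sqrtr1.
Qed.

(** The residual [z = A w - l B^-1 w] is orthogonal to [W] by hypothesis and to N(A) by symmetry of
    [A] and [inv_energy_ortho], hence to itself. *)
Lemma eigenvector_form w l : w \in W ->
  {in W, forall u, dot (A w) u = l * dot (B^-1%VF w) u} -> B (A w) = l *: w.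
Proof.
move=> wW wl; rewrite -[w in RHS]BVK -linearZ; congr (B _); apply/eqP.
rewrite -subr_eq0; set z := _ - _; apply: contraT => /(dot_gt0 dot).
have [u uW zuA] := limg_lker_decomp hA hB z.
have -> : dot z z = dot z u + dot z (z - u) by rewrite -dotDr addrC subrK.
have dotz y : dot z y = dot (A w) y - l * dot (B^-1%VF w) y.
  by rewrite dotDl dotNl dotZl.
rewrite !dotz wl // subrr add0r inv_energy_ortho // mulr0 subr0 hA.1.
by move: zuA; rewrite memv_ker => /eqP ->; rewrite linear0r ltxx.
Qed.

(** Dividing by [l] puts [v] in the range. Thus every nonzero eigenvalue is a value of the Rayleigh
    quotient on [W]. *)
Lemma nonzero_eigenvector v l : l != 0 -> B (A v) = l *: v ->
  v \in W /\ energy v = l * inv_energy v.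
Proof.
move=> l0 BAv; split; last by rewrite -dotZl -linearZ /= -BAv BK.
rewrite -(scalerK l0 v) -BAv memvZ //.
by rewrite -[B (A v)](@comp_lfunE _ _ _ _ B A) memv_img ?memvf.
Qed.

Lemma energy_gt0 w : w \in W -> w != 0 -> 0 < energy w.
Proof.
move=> wW w0; rewrite lt_neqAle hA.2 andbT eq_sym; apply: contra w0 => /eqP.
by move=> /(psd_kerP hA)/(limg_lker_eq0 hA hB wW) ->.
Qed.

Lemma eigenvalue_gt0 w l : w \in W -> w != 0 -> energy w = l * inv_energy w ->
  0 < l.
Proof.
move=> wW w0 wl; have := energy_gt0 wW w0.
by rewrite wl pmulr_lgt0 // (SPD_inv hB).2.
Qed.

Lemma normalized_eigenvector w l : w \in W -> w != 0 ->
  energy w = l * inv_energy w ->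
  exists2 u, u \in W /\ energy u = 1 & inv_energy u = l^-1.
Proof.
move=> wW w0 wl; have e0 := energy_gt0 wW w0.
(* Scaling by [c] divides every quadratic form at [w] by [energy w]. *)
pose c := (Num.sqrt (energy w))^-1.
have qE (T : 'End(V)) : dot (T (c *: w)) (c *: w) = dot (T w) w / energy w.
  rewrite (linearZ_LR T) /= dotZl dotZr mulrA -invfM -expr2 sqr_sqrtr ?ltW //.
  by rewrite mulrC.
exists (c *: w).
  by rewrite memvZ // qE divff ?gt_eqF.
rewrite qE wl; have l0 := eigenvalue_gt0 wW w0 wl.
have c0 : inv_energy w != 0 by rewrite SPD_eq0 //; exact: SPD_inv.
by rewrite invfM mulrCA divff // mulr1.
Qed.

(** * The extremal eigenvalues *)

Lemma limg_neq0 : A != 0 -> W != 0%VS.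
Proof.
apply: contra => /eqP W0; apply/eqP/lfunP => x; rewrite zero_lfunE.
have := memv_img (B \o A) (memvf x); rewrite W0 memv0 comp_lfunE /=.
by move/eqP => BAx; rewrite -(BK (A x)) BAx linear0.
Qed.

(** [l] is the minimum of [energy / inv_energy] on [W]; where the energy is 1, this says that
    [inv_energy] has maximum [l^-1]. *)
Lemma lambda_min_range : A != 0 -> exists2 l, is_lambda_min (B \o A)%VF l &
  l%:E = ((ereal_sup [set inf_kernel_shift dot A B v | v in A_sphere dot A])^-1)%E.
Proof.
move=> /limg_neq0 W0; have hBV := SPD_inv hB.
have A_ge0 : {in W, forall u, 0 * inv_energy u <= energy u}.
  by move=> u _; rewrite mul0r hA.2.
have [l [w [wW w0 lmin wl]]] := rayleigh_min hA.1 hBV A_ge0 W0.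
have l0 := eigenvalue_gt0 wW w0 (wl w wW).
exists l.
  split; [|by rewrite gt_eqF|].
    by apply/leigenvalueP; exists w; rewrite // lfunE /= (eigenvector_form wW wl).
  move=> m /leigenvalueP[v v0]; rewrite lfunE /= => BAv m0.
  have [vW vm] := nonzero_eigenvector m0 BAv.
  by have := lmin v vW; rewrite vm ler_pM2r // hBV.2.
rewrite inf_kernel_shift_image.
suff -> : ereal_sup [set (inv_energy w)%:E | w in [set w | w \in W /\ energy w = 1]]
    = (l^-1)%:E by rewrite inver invr_eq0 gt_eqF // invrK.
have [u [uW uE] ul] := normalized_eigenvector wW w0 (wl w wW).
apply/eqP; rewrite eq_le; apply/andP; split; last first.
  by apply: ereal_sup_ubound; exists u; rewrite ?ul.
apply: ge_ereal_sup => _ [v [vW vE] <-]; rewrite lee_fin.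
by rewrite -[leRHS]mul1r ler_pdivlMr // mulrC -vE lmin.
Qed.

(** The maximum of the quotient is minus the minimum for [- A], which is bounded below by
    [posdef_dominates]. *)
Lemma lambda_max_range : A != 0 -> exists2 l, is_lambda_max (B \o A)%VF l &
  l%:E = ((ereal_inf [set inf_kernel_shift dot A B v | v in A_sphere dot A])^-1)%E.
Proof.
move=> /limg_neq0 W0; have hBV := SPD_inv hB.
have sNA : symmetric_op dot (- A).
  by move=> u v; rewrite !opp_lfunE dotNl dotNr hA.1.
have [K K0 KA] : exists2 K : R, 0 < K & {in <<vbasis W>>%VS, forall u,
    energy u <= K * inv_energy u}.
  apply: (posdef_dominates hA.1 hBV.1 hA.2) => u _; exact: hBV.2.
have NA_ge : {in W, forall u, - K * inv_energy u <= dot ((- A)%VF u) u}.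
  move=> u uW; rewrite opp_lfunE dotNl mulNr lerN2 KA //.
  by rewrite (span_basis (vbasisP W)).
have [l [w [wW w0 lmin wl]]] := rayleigh_min sNA hBV NA_ge W0.
have {}lmin : {in W, forall u, energy u <= - l * inv_energy u}.
  by move=> u /lmin; rewrite opp_lfunE dotNl mulNr lerNr.
have {}wl : {in W, forall u, dot (A w) u = - l * dot (B^-1%VF w) u}.
  by move=> u /wl; rewrite opp_lfunE dotNl mulNr => <-; rewrite opprK.
move: (- l) lmin wl => {}l lmax wl.
have l0 := eigenvalue_gt0 wW w0 (wl w wW).
exists l.
  split.
    by apply/leigenvalueP; exists w; rewrite // lfunE /= (eigenvector_form wW wl).
  move=> m /leigenvalueP[v v0]; rewrite lfunE /= => BAv.
  (* Here [m = 0] is a competitor too; it lies below the positive [l]. *)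
  have [->|m0] := eqVneq m 0; first exact: ltW.
  have [vW vm] := nonzero_eigenvector m0 BAv.
  by have := lmax v vW; rewrite vm ler_pM2r // hBV.2.
rewrite inf_kernel_shift_image.
suff -> : ereal_inf [set (inv_energy w)%:E | w in [set w | w \in W /\ energy w = 1]]
    = (l^-1)%:E by rewrite inver invr_eq0 gt_eqF // invrK.
have [u [uW uE] ul] := normalized_eigenvector wW w0 (wl w wW).
apply/eqP; rewrite eq_le; apply/andP; split.
  by apply: ereal_inf_lbound; exists u; rewrite ?ul.
apply: le_ereal_inf_tmp => _ [v [vW vE] <-]; rewrite lee_fin.
by rewrite -[leLHS]mul1r ler_pdivrMr // mulrC -vE lmax.
Qed.

End RangeEnergy.

Theorem theorem4p5 (R : realType) (V : vectType R) (dot : {dot V for idfun})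
    (A B : 'End(V)) (hA : SPSD dot A) (hB : SPD dot B) :
  (A != 0 ->
     exists2 lmin : R, is_lambda_min (B \o A)%VF lmin &
       lmin%:E = ((ereal_sup [set inf_kernel_shift dot A B v
                             | v in A_sphere dot A])^-1)%E)
  /\
  ({:V}%VS != 0%VS ->
     exists2 lmax : R, is_lambda_max (B \o A)%VF lmax &
       lmax%:E = ((ereal_inf [set inf_kernel_shift dot A B v
                             | v in A_sphere dot A])^-1)%E).
Proof.
split=> [A0|V0]; first exact: lambda_min_range.
(* For [A = 0] the only eigenvalue is 0, and the sphere is empty: its infimum is [+oo], whose
   inverse is 0. *)
have [A0|A0] := eqVneq A 0; last exact: lambda_max_range.
have BA0 : (B \o A)%VF = 0 by rewrite A0 comp_lfun0r.
exists 0.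
  split.
    apply/leigenvalueP; exists (vpick {:V}); first by rewrite vpick0.
    by rewrite BA0 zero_lfunE scale0r.
  move=> m /leigenvalueP[v v0]; rewrite BA0 zero_lfunE => /esym/eqP.
  by rewrite scaler_eq0 (negPf v0) orbF => /eqP ->.
suff -> : A_sphere dot A = set0 by rewrite image_set0 ereal_inf0.
rewrite -subset0 => v [_]; rewrite /seminorm A0 zero_lfunE linear0l sqrtr0.
by move/eqP; rewrite eq_sym oner_eq0.
Qed.
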